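(* Let $\ell\geqslant 1$, $r\geqslant 2$ and $k\geqslant 1$ be integers such that $k$ divides $r$. Let $p$ be a prime number and $q=p^{s}$ where $s\geqslant 1$ is an integer. Let $(u(1),u(2),\ldots,u(\ell))$ be given in $\mathbb{F}_{q}^{\ell}$. Let $\alpha_{i+1}\in\mathbb{F}_{q}^{*}$ ($0\leqslant i<k$) and $\beta_{i,j}\in\mathbb{F}_{q}$ ($0\leqslant i<k$, $1\leqslant j<r$) be fixed elements, and let $\gamma\geqslant 1$ be an integer coprime with $q-1$. Let $u=(u(n))_{n\geqslant 1}$ be the sequence in the finite field $\mathbb{F}_{q}$ with these first $\ell$ terms such that, for all integers $m\geqslant 0$ and $0\leqslant i<k$, $$u(\ell+1+r(km+i))=\alpha_{i+1}\,(u(km+i+1))^{\gamma},$$ $$u(\ell+1+r(km+i)+j)=\beta_{i,j}\quad\text{for } 1\leqslant j<r.$$ Then the sequence $u$ is $r$-automatic.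
   Context: $\mathbb{F}_{q}$ is the finite field with $q$ elements and $\mathbb{F}_{q}^{*}$ its set of nonzero elements. For an integer $r\geqslant 2$, a sequence $v=(v(n))_{n\geqslant 1}$ with values in a finite set is called $r$-automatic if its $r$-kernel $K_{r}(v)=\{(v(r^{a}n+b))_{n\geqslant 1}\mid a\geqslant 0,\ 0\leqslant b<r^{a}\}$ is a finite set of sequences. *)

(* Defs.v *)
From mathcomp Require Import all_boot all_order all_algebra.
From mathcomp Require Import all_classical.

Set Implicit Arguments.
Unset Strict Implicit.
Unset Printing Implicit Defensive.

Local Open Scope classical_set_scope.
Local Open Scope nat_scope.

(* A sequence (v(n))_{n >= 1} is encoded by a function v : nat -> T whose value
   at 0 is irrelevant.  The members of the kernel, again sequences indexed by
   n >= 1, must not depend on such an irrelevant value for the kernel to have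
   the right cardinality: they are therefore stored as functions of m = n - 1. *)
Definition kernel (T : Type) (r : nat) (v : nat -> T) : set (nat -> T) :=
  [set w | exists a b : nat,
     b < r ^ a /\ w = (fun m : nat => v (r ^ a * m.+1 + b))].

Definition automatic (T : finType) (r : nat) (v : nat -> T) : Prop :=
  finite_set (kernel r v).

(* Main.v *)
Require Import Defs.
From mathcomp Require Import all_boot all_order all_algebra.
From mathcomp Require Import all_classical.
From mathcomp Require Import zify.

(** The relations defining [u] say that, for [n >= 0] and [j < r],
    [u (l + 1 + r * n + j)] is the image of [u (n + 1)] under a self-map of the
    field (either [x |-> alpha x ^ gamma] or a constant) that depends only on
    [j] and on [n] modulo [k].

    Consider, for [c < r ^ a + l], the sequences [m |-> u (r ^ a (m + 1) + c + 1
    - l)].  They include the [r]-kernel, and the window for [c] is chosen to be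
    stable under the relation: when [a > l], the sequence at level [a] is
    obtained from one at level [a - 1] by applying one self-map, the same for
    all [m] because [k] divides [r ^ (a - 1)] ([window_descent]).  Levels above
    [l] are large enough for the indices involved to stay out of the range
    covered by the initial values.  Descending to level at most [l], every
    member of the kernel is [f] composed with one of finitely many fixed
    sequences, where [f] is a composite of such self-maps ([kernel_window]).
    Since a finite set has only finitely many self-maps, the kernel is finite
    ([automatic_of_recurrence]). *)

Local Open Scope nat_scope.

(** The shift by [l] lets offsets run over the integers from [1 - l] to
    [r ^ a], a range that [x |-> floor ((x - 1 - l) / r) + 1], the effect of the
    recurrence on offsets, maps into the range of the level below. *)
Definition window {T : Type} (r l : nat) (u : nat -> T) (a c : nat) : nat -> T :=
  fun m => u (r ^ a * m.+1 + c.+1 - l).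

(** The new offset [d] and the digit [j] are the quotient and the remainder in
    [(c - l) - l = r * (d - l) + j]; adding [r * l] keeps everything in the
    natural numbers. *)
Lemma window_descent {T : Type} {l r k : nat} {u : nat -> T}
    {g : nat -> nat -> T -> T} {a : nat} (c : nat) :
  1 < r -> k %| r ->
  (forall n j, j < r -> u (l + 1 + r * n + j) = g (n %% k) j (u n.+1)) ->
  0 < a -> l <= r ^ a -> c < r ^ a.+1 + l ->
  exists f d, d < r ^ a + l /\
    window r l u a.+1 c = (fun m => f (window r l u a d m)).
Proof.
move=> r_gt1 k_dvd_r u_rec a_gt0 le_l_ra c_lt.
pose d := (c + (r - 2) * l) %/ r; pose j := (c + (r - 2) * l) %% r.
have dj : c + (r - 2) * l = d * r + j by exact: divn_eq.
have j_lt : j < r by rewrite ltn_mod; lia.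
have k_dvd_ra : k %| r ^ a by rewrite (dvdn_trans k_dvd_r) // dvdn_exp.
exists (g ((r ^ a + d - l) %% k) j), d; split.
  by rewrite ltn_divLR ?mulnDl -?expnSr; nia.
apply/funext => m; rewrite /window.
pose n := r ^ a * m.+1 + d - l.
have nE : r ^ a * m.+1 + d = n + l by rewrite subnK //; nia.
have -> : r ^ a * m.+1 + d.+1 - l = n.+1 by lia.
(* The residue of the index modulo [k] is the one found at [m = 0]. *)
have -> : (r ^ a + d - l) %% k = n %% k.
  have -> : n = r ^ a * m + (r ^ a + d - l) by rewrite mulnS in nE; lia.
  by rewrite -modnDml (eqP (dvdn_mulr m k_dvd_ra)).
rewrite -u_rec //; congr u.
have := congr1 (muln r) nE; rewrite !mulnDr mulnA -expnS => rnE.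
rewrite mulnBl in dj; have : 2 * l <= r * l by rewrite leq_mul2r r_gt1 orbT.
lia.
Qed.

(** Levels up to [l] are finitely many and are left alone; from higher ones the
    descent is iterated, which is possible because [l <= r ^ l], and the
    self-maps met on the way compose into one. *)
Lemma kernel_window {T : Type} {l r k : nat} {u : nat -> T}
    {g : nat -> nat -> T -> T} (a c : nat) :
  0 < l -> 1 < r -> k %| r ->
  (forall n j, j < r -> u (l + 1 + r * n + j) = g (n %% k) j (u n.+1)) ->
  c < r ^ a + l ->
  exists f a' c', [/\ a' <= l, c' < r ^ l + l &
    window r l u a c = (fun m => f (window r l u a' c' m))].
Proof.
move=> l_gt0 r_gt1 k_dvd_r u_rec.
elim: a c => [|a IHa] c c_lt.
  exists id, 0, c; split=> //.
  by rewrite (leq_trans c_lt) // leq_add2r leq_exp2l.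
have [le_al | lt_la] := leqP a.+1 l.
  exists id, a.+1, c; split=> //.
  by rewrite (leq_trans c_lt) // leq_add2r leq_exp2l.
have le_l_ra : l <= r ^ a.
  by rewrite (leq_trans (ltnW (ltn_expl l r_gt1))) // leq_exp2l.
have a_gt0 : 0 < a by lia.
have [f [d [d_lt ->]]] :=
  window_descent c r_gt1 k_dvd_r u_rec a_gt0 le_l_ra c_lt.
have [f' [a' [c' [le_a' c'_lt ->]]]] := IHa d d_lt.
by exists (f \o f'), a', c'.
Qed.

(** Finiteness of [T] enters through the finiteness of the type of its
    self-maps, which together with the level and the offset index the
    kernel. *)
Lemma automatic_of_recurrence (T : finType) (l r k : nat) (u : nat -> T)
    (g : nat -> nat -> T -> T) :
  0 < l -> 1 < r -> k %| r ->
  (forall n j, j < r -> u (l + 1 + r * n + j) = g (n %% k) j (u n.+1)) ->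
  automatic r u.
Proof.
move=> l_gt0 r_gt1 k_dvd_r u_rec; rewrite /automatic.
pose w (x : {ffun T -> T} * 'I_l.+1 * 'I_(r ^ l + l)) : nat -> T :=
  fun m => x.1.1 (window r l u x.1.2 x.2 m).
apply: (@sub_finite_set _ _ (w @` setT)%classic); last first.
  exact/finite_image/finite_finset.
move=> _ [a [b [b_lt ->]]].
have c_lt : b + l.-1 < r ^ a + l by lia.
have [f [a' [c' [le_a' c'_lt Ew]]]] :=
  kernel_window _ _ l_gt0 r_gt1 k_dvd_r u_rec c_lt.
exists (finfun f, Ordinal (le_a' : a' < l.+1), Ordinal c'_lt) => //.
apply/funext => m; rewrite /w /= ffunE -[LHS]/((fun m => f _) m) -Ew /window.
by congr u; lia.
Qed.

Theorem theorem4 (l r k : nat) (hl : 1 <= l) (hr : 2 <= r) (hk : 1 <= k)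
  (hkr : k %| r)
  (p s q : nat) (hp : prime p) (hs : 1 <= s) (hq : q = p ^ s)
  (F : finFieldType) (hF : #|F| = q)
  (u0 : 'I_l -> F)
  (alpha : nat -> F) (halpha : forall i : nat, i < k -> alpha i.+1 <> 0%R)
  (beta : nat -> nat -> F)
  (gamma : nat) (hgamma : 1 <= gamma) (hcop : coprime gamma (q - 1))
  (u : nat -> F)
  (hinit : forall i : 'I_l, u i.+1 = u0 i)
  (hrec : forall m i : nat, i < k ->
     u (l + 1 + r * (k * m + i)) =
       (alpha i.+1 * u (k * m + i + 1)%N ^+ gamma)%R)
  (hbeta : forall m i j : nat, i < k -> 1 <= j < r ->
     u (l + 1 + r * (k * m + i) + j) = beta i j) :
  automatic r u.
Proof.
pose g i j (x : F) := if j is 0 then (alpha i.+1 * x ^+ gamma)%R else beta i j.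
apply: (@automatic_of_recurrence F l r k u g hl hr hkr) => n j j_lt.
have n_lt : n %% k < k by rewrite ltn_mod.
have En : n = k * (n %/ k) + n %% k by rewrite mulnC -divn_eq.
case: j j_lt => [_ | j j_lt]; rewrite [in LHS]En.
  by rewrite addn0 hrec // -En addn1.
by rewrite hbeta.
Qed.
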